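(* Let $N_1,N_2\in\mathbb{N}$ (positive integers), let $\alpha=(\alpha_0,\alpha_1)$ with $\alpha_0>0$, $\alpha_1>0$, and let $u:\{1,\ldots,N_1\}\times\{1,\ldots,N_2\}\to\mathbb{R}$. Let $\mathcal{R}u:\{1,\ldots,N_2\}\times\{1,\ldots,N_1\}\to\mathbb{R}$ be the $90^\circ$ rotated image $$(\mathcal{R}u)(n_1,n_2)=u(n_2,\,N_2-n_1+1),\qquad n_1=1,\ldots,N_2,\ n_2=1,\ldots,N_1.$$ Then $$\mathrm{TGV}_\alpha^{2(new)}(\mathcal{R}u)=\mathrm{TGV}_\alpha^{2(new)}(u),$$ where $\mathrm{TGV}_\alpha^{2(new)}$ is the discrete second-order total generalized variation defined in the context; on the right-hand side it is taken for image size $N_1\times N_2$, and on the left-hand side for image size $N_2\times N_1$ (i.e. with $N_1$ and $N_2$ interchanged in all definitions).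
   Context: Grids. For positive integers $N_1,N_2$ define $A_\bullet=\{1,\ldots,N_1\}\times\{1,\ldots,N_2\}$, $A_\leftrightarrow=\{\tfrac12,\tfrac32,\ldots,N_1+\tfrac12\}\times\{1,\ldots,N_2\}$, $A_\updownarrow=\{1,\ldots,N_1\}\times\{\tfrac12,\tfrac32,\ldots,N_2+\tfrac12\}$, $\bar A_\bullet^x=\{0,1,\ldots,N_1+1\}\times\{1,\ldots,N_2\}$, $\bar A_\bullet^y=\{1,\ldots,N_1\}\times\{0,1,\ldots,N_2+1\}$, $A_\times=\{\tfrac12,\tfrac32,\ldots,N_1+\tfrac12\}\times\{\tfrac12,\tfrac32,\ldots,N_2+\tfrac12\}$. Let $\mathcal{U}_\bullet,\mathcal{U}_\leftrightarrow,\mathcal{U}_\updownarrow,\bar{\mathcal{U}}_\bullet^x,\bar{\mathcal{U}}_\bullet^y,\mathcal{U}_\times$ be the spaces of real-valued functions on the respective grids. Inner products. On each of these spaces $\langle a,b\rangle=\sum a(n_1,n_2)b(n_1,n_2)$ (sum over the grid); on products of two spaces, the sum of the componentwise inner products; on $\bar{\mathcal{U}}_\bullet^x\times\bar{\mathcal{U}}_\bullet^y\times\mathcal{U}_\times$ (whose elements $(v_1,v_2,v_3)$ represent symmetric matrix fields with diagonal $v_1,v_2$ and off-diagonal $v_3$), $\langle v,v'\rangle=\langle v_1,v_1'\rangle+\langle v_2,v_2'\rangle+2\langle v_3,v_3'\rangle$. Difference operators. $\mathcal{D}^{new}:\mathcal{U}_\bullet\to\mathcal{U}_\leftrightarrow\times\mathcal{U}_\updownarrow$: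 $(\mathcal{D}^{new}u)_1(n_1,n_2)=u(n_1+\tfrac12,n_2)-u(n_1-\tfrac12,n_2)$ if $\tfrac32\le n_1\le N_1-\tfrac12$, and $0$ otherwise; $(\mathcal{D}^{new}u)_2(n_1,n_2)=u(n_1,n_2+\tfrac12)-u(n_1,n_2-\tfrac12)$ if $\tfrac32\le n_2\le N_2-\tfrac12$, and $0$ otherwise. $\mathcal{E}^{new}:\mathcal{U}_\leftrightarrow\times\mathcal{U}_\updownarrow\to\bar{\mathcal{U}}_\bullet^x\times\bar{\mathcal{U}}_\bullet^y\times\mathcal{U}_\times$: $(\mathcal{E}^{new}w)_1(n_1,n_2)=w_1(n_1+\tfrac12,n_2)-w_1(n_1-\tfrac12,n_2)$ if $1\le n_1\le N_1$, and $0$ otherwise; $(\mathcal{E}^{new}w)_2(n_1,n_2)=w_2(n_1,n_2+\tfrac12)-w_2(n_1,n_2-\tfrac12)$ if $1\le n_2\le N_2$, and $0$ otherwise; $(\mathcal{E}^{new}w)_3=\tfrac12(p+q)$, where $p(n_1,n_2)=w_1(n_1,n_2+\tfrac12)-w_1(n_1,n_2-\tfrac12)$ if $\tfrac32\le n_2\le N_2-\tfrac12$ and $0$ otherwise, and $q(n_1,n_2)=w_2(n_1+\tfrac12,n_2)-w_2(n_1-\tfrac12,n_2)$ if $\tfrac32\le n_1\le N_1-\tfrac12$ and $0$ otherwise. Divergences: $\mathrm{div}^{new}=-(\mathcal{D}^{new})^*:\mathcal{U}_\leftrightarrow\times\mathcal{U}_\updownarrow\to\mathcal{U}_\bullet$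 and $\mathrm{Div}^{new}=-(\mathcal{E}^{new})^*:\bar{\mathcal{U}}_\bullet^x\times\bar{\mathcal{U}}_\bullet^y\times\mathcal{U}_\times\to\mathcal{U}_\leftrightarrow\times\mathcal{U}_\updownarrow$, adjoints with respect to the inner products above. Explicitly, $(\mathrm{div}^{new}w)(n_1,n_2)=\tilde w_1(n_1+\tfrac12,n_2)-\tilde w_1(n_1-\tfrac12,n_2)+\tilde w_2(n_1,n_2+\tfrac12)-\tilde w_2(n_1,n_2-\tfrac12)$, where $\tilde w_1$ equals $w_1$ except that it is set to $0$ for $n_1\in\{\tfrac12,N_1+\tfrac12\}$, and $\tilde w_2$ equals $w_2$ except that it is set to $0$ for $n_2\in\{\tfrac12,N_2+\tfrac12\}$. Also $(\mathrm{Div}^{new}v)_1(n_1,n_2)=\tilde v_1(n_1+\tfrac12,n_2)-\tilde v_1(n_1-\tfrac12,n_2)+\tilde v_3^{y}(n_1,n_2+\tfrac12)-\tilde v_3^{y}(n_1,n_2-\tfrac12)$ and $(\mathrm{Div}^{new}v)_2(n_1,n_2)=\tilde v_2(n_1,n_2+\tfrac12)-\tilde v_2(n_1,n_2-\tfrac12)+\tilde v_3^{x}(n_1+\tfrac12,n_2)-\tilde v_3^{x}(n_1-\tfrac12,n_2)$, where $\tilde v_1$ is $v_1$ set to $0$ for $n_1\in\{0,N_1+1\}$, $\tilde v_2$ is $v_2$ set to $0$ for $n_2\in\{0,N_2+1\}$, $\tilde v_3^{y}$ is $v_3$ set to $0$ for $n_2\in\{\tfrac12,N_2+\tfrac12\}$,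 and $\tilde v_3^{x}$ is $v_3$ set to $0$ for $n_1\in\{\tfrac12,N_1+\tfrac12\}$. Conversion operators. For $w=(w_1,w_2)\in\mathcal{U}_\leftrightarrow\times\mathcal{U}_\updownarrow$, with values of $w_1,w_2$ outside their grids taken to be $0$: $L_\bullet:\mathcal{U}_\leftrightarrow\times\mathcal{U}_\updownarrow\to\mathcal{U}_\bullet^2$: $(L_\bullet w)_1(n_1,n_2)=\tfrac12(w_1(n_1+\tfrac12,n_2)+w_1(n_1-\tfrac12,n_2))$, $(L_\bullet w)_2(n_1,n_2)=\tfrac12(w_2(n_1,n_2+\tfrac12)+w_2(n_1,n_2-\tfrac12))$. $L_\leftrightarrow:\mathcal{U}_\leftrightarrow\times\mathcal{U}_\updownarrow\to\mathcal{U}_\leftrightarrow^2$: $(L_\leftrightarrow w)_1=w_1$, $(L_\leftrightarrow w)_2(n_1,n_2)=\tfrac14\sum_{\epsilon,\delta\in\{-1/2,1/2\}}w_2(n_1+\epsilon,n_2+\delta)$. $L_\updownarrow:\mathcal{U}_\leftrightarrow\times\mathcal{U}_\updownarrow\to\mathcal{U}_\updownarrow^2$: $(L_\updownarrow w)_1(n_1,n_2)=\tfrac14\sum_{\epsilon,\delta\in\{-1/2,1/2\}}w_1(n_1+\epsilon,n_2+\delta)$, $(L_\updownarrow w)_2=w_2$. For $v=(v_1,v_2,v_3)\in\bar{\mathcal{U}}_\bullet^x\times\bar{\mathcal{U}}_\bullet^y\times\mathcal{U}_\times$, the operator (same symbol) $L_\bullet:\bar{\mathcal{U}}_\bullet^x\times\bar{\mathcal{U}}_\bullet^y\times\mathcal{U}_\times\to\mathcal{U}_\bullet^3$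 is, for $(n_1,n_2)\in A_\bullet$: $(L_\bullet v)_1(n_1,n_2)=v_1(n_1,n_2)$, $(L_\bullet v)_2(n_1,n_2)=v_2(n_1,n_2)$, $(L_\bullet v)_3(n_1,n_2)=\tfrac14\sum_{\epsilon,\delta\in\{-1/2,1/2\}}v_3(n_1+\epsilon,n_2+\delta)$. Norms. For $\star\in\{\bullet,\leftrightarrow,\updownarrow\}$, $\|L_\star w\|_\infty=\max_{(n_1,n_2)\in A_\star}\sqrt{(L_\star w)_1(n_1,n_2)^2+(L_\star w)_2(n_1,n_2)^2}$, and $\|L_\bullet v\|_\infty=\max_{(n_1,n_2)\in A_\bullet}\sqrt{(L_\bullet v)_1(n_1,n_2)^2+(L_\bullet v)_2(n_1,n_2)^2+2(L_\bullet v)_3(n_1,n_2)^2}$. The functional. For $\alpha_0,\alpha_1>0$ and $u\in\mathcal{U}_\bullet$, $$\mathrm{TGV}_\alpha^{2(new)}(u)=\max\bigl\{\langle u,s\rangle:\ v\in\bar{\mathcal{U}}_\bullet^x\times\bar{\mathcal{U}}_\bullet^y\times\mathcal{U}_\times,\ w=\mathrm{Div}^{new}v,\ s=\mathrm{div}^{new}w,\ \|L_\bullet v\|_\infty\le\alpha_0,\ \|L_\bullet w\|_\infty\le\alpha_1,\ \|L_\leftrightarrow w\|_\infty\le\alpha_1,\ \|L_\updownarrow w\|_\infty\le\alpha_1\bigr\}.$$ *)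

(* Defs.v *)
From HB Require Import structures.
From mathcomp Require Import all_boot all_order all_algebra.
From mathcomp Require Import all_classical all_reals all_analysis.
From mathcomp Require Import ring lra.
Import Order.TTheory GRing.Theory Num.Theory.
Import numFieldNormedType.Exports.

Set Implicit Arguments.
Unset Strict Implicit.
Unset Printing Implicit Defensive.

Local Open Scope classical_set_scope.
Local Open Scope ring_scope.

(* Grid points are kept at their actual (half-)integer coordinates, as
   elements of rat * rat. *)
Definition halfq : rat := 1 / 2.

Definition cells (N : nat) : seq rat := [seq n%:R | n <- iota 1 N].
Definition edges (N : nat) : seq rat := [seq n%:R + halfq | n <- iota 0 N.+1].
Definition ghosted (N : nat) : seq rat := [seq n%:R | n <- iota 0 N.+2].

Definition grid (X Y : seq rat) : seq (rat * rat) :=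
  [seq (x, y) | x <- X, y <- Y].

Definition A_bullet (N1 N2 : nat) := grid (cells N1) (cells N2).
Definition A_hor (N1 N2 : nat) := grid (edges N1) (cells N2).
Definition A_ver (N1 N2 : nat) := grid (cells N1) (edges N2).
Definition A_barx (N1 N2 : nat) := grid (ghosted N1) (cells N2).
Definition A_bary (N1 N2 : nat) := grid (cells N1) (ghosted N2).
Definition A_cross (N1 N2 : nat) := grid (edges N1) (edges N2).

Notation U R A := {ffun seq_sub A -> (R : Type)}.

Definition U2 (R : realType) (N1 N2 : nat) : Type :=
  (U R (A_hor N1 N2) * U R (A_ver N1 N2))%type.
Definition U3 (R : realType) (N1 N2 : nat) : Type :=
  (U R (A_barx N1 N2) * U R (A_bary N1 N2) * U R (A_cross N1 N2))%type.

(* The value of f at the point (x, y), and 0 when (x, y) is off the grid. *)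
Definition ev (R : realType) (A : seq (rat * rat)) (f : U R A) (x y : rat) : R :=
  if insub (x, y) is Some p then f p else 0.

Definition on_grid (R : realType) (A : seq (rat * rat)) (F : rat -> rat -> R) :
    U R A :=
  [ffun p => F (val p).1 (val p).2].
Arguments on_grid {R} A F.

Definition ip (R : realType) (A : seq (rat * rat)) (a b : U R A) : R :=
  \sum_p a p * b p.

Definition ip2 (R : realType) (N1 N2 : nat) (w w' : U2 R N1 N2) : R :=
  ip w.1 w'.1 + ip w.2 w'.2.

Definition ip3 (R : realType) (N1 N2 : nat) (v v' : U3 R N1 N2) : R :=
  ip v.1.1 v'.1.1 + ip v.1.2 v'.1.2 + 2 * ip v.2 v'.2.

Definition Dnew (R : realType) (N1 N2 : nat) (u : U R (A_bullet N1 N2)) :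
    U2 R N1 N2 :=
  (on_grid _ (fun x y =>
     if 3 / 2 <= x <= N1%:R - halfq
     then ev u (x + halfq) y - ev u (x - halfq) y else 0),
   on_grid _ (fun x y =>
     if 3 / 2 <= y <= N2%:R - halfq
     then ev u x (y + halfq) - ev u x (y - halfq) else 0)).

Definition Enew (R : realType) (N1 N2 : nat) (w : U2 R N1 N2) : U3 R N1 N2 :=
  (on_grid _ (fun x y =>
     if 1 <= x <= N1%:R
     then ev w.1 (x + halfq) y - ev w.1 (x - halfq) y else 0),
   on_grid _ (fun x y =>
     if 1 <= y <= N2%:R
     then ev w.2 x (y + halfq) - ev w.2 x (y - halfq) else 0),
   on_grid _ (fun x y =>
     let p := if 3 / 2 <= y <= N2%:R - halfq
              then ev w.1 x (y + halfq) - ev w.1 x (y - halfq) else 0 in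
     let q := if 3 / 2 <= x <= N1%:R - halfq
              then ev w.2 (x + halfq) y - ev w.2 (x - halfq) y else 0 in
     (p + q) / 2)).

(* div^new and Div^new are given by their explicit formulas; divnew_adjoint
   and Divnew_adjoint below show that they are -(D^new)^* and -(E^new)^*. *)
Definition divnew (R : realType) (N1 N2 : nat) (w : U2 R N1 N2) :
    U R (A_bullet N1 N2) :=
  let w1 x y := if x \in [:: halfq; N1%:R + halfq] then 0 else ev w.1 x y in
  let w2 x y := if y \in [:: halfq; N2%:R + halfq] then 0 else ev w.2 x y in
  on_grid _ (fun x y =>
    w1 (x + halfq) y - w1 (x - halfq) y + w2 x (y + halfq) - w2 x (y - halfq)).

Definition Divnew (R : realType) (N1 N2 : nat) (v : U3 R N1 N2) :
    U2 R N1 N2 :=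
  let v1 x y := if x \in [:: 0; N1%:R + 1] then 0 else ev v.1.1 x y in
  let v2 x y := if y \in [:: 0; N2%:R + 1] then 0 else ev v.1.2 x y in
  let v3x x y := if x \in [:: halfq; N1%:R + halfq] then 0 else ev v.2 x y in
  let v3y x y := if y \in [:: halfq; N2%:R + halfq] then 0 else ev v.2 x y in
  (on_grid _ (fun x y =>
     v1 (x + halfq) y - v1 (x - halfq) y + v3y x (y + halfq) - v3y x (y - halfq)),
   on_grid _ (fun x y =>
     v2 x (y + halfq) - v2 x (y - halfq) + v3x (x + halfq) y - v3x (x - halfq) y)).

Definition avg4 (R : realType) (A : seq (rat * rat)) (f : U R A) (x y : rat) : R :=
  4^-1 * \sum_(e <- [:: - halfq; halfq]) \sum_(d <- [:: - halfq; halfq])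
           ev f (x + e) (y + d).

Definition L_bullet (R : realType) (N1 N2 : nat) (w : U2 R N1 N2) :
    U R (A_bullet N1 N2) * U R (A_bullet N1 N2) :=
  (on_grid _ (fun x y => 2^-1 * (ev w.1 (x + halfq) y + ev w.1 (x - halfq) y)),
   on_grid _ (fun x y => 2^-1 * (ev w.2 x (y + halfq) + ev w.2 x (y - halfq)))).

Definition L_hor (R : realType) (N1 N2 : nat) (w : U2 R N1 N2) :
    U R (A_hor N1 N2) * U R (A_hor N1 N2) :=
  (w.1, on_grid _ (avg4 w.2)).

Definition L_ver (R : realType) (N1 N2 : nat) (w : U2 R N1 N2) :
    U R (A_ver N1 N2) * U R (A_ver N1 N2) :=
  (on_grid _ (avg4 w.1), w.2).

Definition L_bullet3 (R : realType) (N1 N2 : nat) (v : U3 R N1 N2) :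
    U R (A_bullet N1 N2) * U R (A_bullet N1 N2) * U R (A_bullet N1 N2) :=
  (on_grid _ (ev v.1.1), on_grid _ (ev v.1.2), on_grid _ (avg4 v.2)).

(* The maxima range over nonempty grids and over nonnegative quantities, so
   the default value 0 of the iterated maximum is harmless. *)
Definition norm2 (R : realType) (A : seq (rat * rat)) (f : U R A * U R A) : R :=
  \big[Num.max/0]_p Num.sqrt (f.1 p ^+ 2 + f.2 p ^+ 2).

Definition norm3 (R : realType) (A : seq (rat * rat))
    (f : U R A * U R A * U R A) : R :=
  \big[Num.max/0]_p
    Num.sqrt (f.1.1 p ^+ 2 + f.1.2 p ^+ 2 + 2 * f.2 p ^+ 2).

Definition tgv_admissible (R : realType) (N1 N2 : nat) (a0 a1 : R) :
    set (U3 R N1 N2) :=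
  [set v | let w := Divnew v in
    [/\ norm3 (L_bullet3 v) <= a0,
        norm2 (L_bullet w) <= a1,
        norm2 (L_hor w) <= a1
      & norm2 (L_ver w) <= a1]].
Arguments tgv_admissible {R} N1 N2 a0 a1.

Definition tgv_values (R : realType) (N1 N2 : nat) (a0 a1 : R)
    (u : U R (A_bullet N1 N2)) : set R :=
  [set ip u (divnew (Divnew v)) | v in tgv_admissible N1 N2 a0 a1].

(* This supremum is attained: see TGV2new_max below. *)
Definition TGV2new (R : realType) (N1 N2 : nat) (a0 a1 : R)
    (u : U R (A_bullet N1 N2)) : R :=
  sup (tgv_values a0 a1 u).

Definition rotate90 (R : realType) (N1 N2 : nat) (u : U R (A_bullet N1 N2)) :
    U R (A_bullet N2 N1) :=
  on_grid _ (fun x y => ev u y (N2%:R - x + 1)).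

Lemma evE (R : realType) (A : seq (rat * rat)) (f : U R A) x y :
  ev f x y = \sum_q (if val q == (x, y) then f q else 0).
Proof.
rewrite /ev; case: insubP => [p _ vp|xyA].
  rewrite (bigD1 p) //= vp eqxx big1 ?addr0 // => q qp.
  by rewrite -vp val_eqE (negbTE qp).
by rewrite big1 // => q _; case: eqP => // vq; rewrite -vq (valP q) in xyA.
Qed.

Lemma evval (R : realType) (A : seq (rat * rat)) (f : U R A) p :
  ev f (val p).1 (val p).2 = f p.
Proof. by rewrite /ev -surjective_pairing valK. Qed.

Lemma ip_shift (R : realType) (A B : seq (rat * rat)) (a : U R A) (b : U R B) s t :
  \sum_p a p * ev b ((val p).1 + s) ((val p).2 + t) =
  \sum_q b q * ev a ((val q).1 - s) ((val q).2 - t).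
Proof.
under eq_bigr do rewrite evE mulr_sumr.
under [RHS]eq_bigr do rewrite evE mulr_sumr.
rewrite exchange_big; apply: eq_bigr => q _; apply: eq_bigr => p _.
have -> : (val p == ((val q).1 - s, (val q).2 - t)) =
          (val q == ((val p).1 + s, (val p).2 + t)).
  case: (val p) (val q) => [x y] [x' y'] /=.
  by rewrite eq_sym !xpair_eqE !subr_eq.
by case: ifP; rewrite ?mulr0 // mulrC.
Qed.

Lemma ip_diff (R : realType) (A B : seq (rat * rat)) (a : U R A) (b : U R B)
    (g bad : rat -> rat -> bool) s t :
    {in B, forall z, g z.1 z.2 = ~~ bad z.1 z.2} ->
  let bt x y := if bad x y then 0 else ev b x y in
  \sum_(p : seq_sub B) (if g (val p).1 (val p).2
     then ev a ((val p).1 + s) ((val p).2 + t)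
          - ev a ((val p).1 - s) ((val p).2 - t) else 0) * b p =
  - \sum_q a q * (bt ((val q).1 + s) ((val q).2 + t)
                  - bt ((val q).1 - s) ((val q).2 - t)).
Proof.
move=> gbad bt; pose b' : U R B := on_grid B bt.
have btE x y : bt x y = ev b' x y.
  rewrite /bt /ev; case: insubP => [p _ vp|_]; last by rewrite if_same.
  by rewrite ffunE /bt evval vp.
transitivity (\sum_p b' p * ev a ((val p).1 + s) ((val p).2 + t)
   - \sum_p b' p * ev a ((val p).1 + (- s)) ((val p).2 + (- t))).
  rewrite -sumrB; apply: eq_bigr => p _.
  rewrite ffunE gbad ?(valP p) // /bt evval.
  by case: (bad _ _) => /=; rewrite ?mul0r ?subrr // -mulrBr mulrC.
rewrite (ip_shift b' a s t) (ip_shift b' a (- s) (- t)) -sumrB -sumrN; apply: eq_bigr => q _.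
by rewrite !btE !opprK mulrBr opprB.
Qed.

Lemma edge_guard (N : nat) (x : rat) : x \in edges N ->
  (3 / 2 <= x <= N%:R - halfq) = (x \notin [:: halfq; N%:R + halfq]).
Proof.
case/mapP => n; rewrite mem_iota add0n ltnS => /andP[_ nN] ->.
rewrite !inE /halfq negb_or (inj_eq (addIr _)) eqr_nat.
have -> : (n%:R + 1 / 2 == 1 / 2 :> rat) = (n == 0%N).
  by rewrite -[X in _ == X]add0r (inj_eq (addIr _)) pnatr_eq0.
have -> : (3 / 2 <= n%:R + 1 / 2 :> rat) = (n != 0%N).
  by rewrite -lt0n -(ler_nat rat); apply/idP/idP; lra.
have -> : (n != N) = (n.+1 <= N)%N by rewrite ltn_neqAle nN andbT.
rewrite -(ler_nat rat n.+1) -(@natr1 _ n); congr andb.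
by apply/idP/idP; lra.
Qed.

Lemma ghosted_guard (N : nat) (x : rat) : x \in ghosted N ->
  (1 <= x <= N%:R) = (x \notin [:: 0; N%:R + 1]).
Proof.
case/mapP => n; rewrite mem_iota add0n ltnS => /andP[_ nN] ->.
rewrite !inE negb_or natr1 eqr_nat pnatr_eq0 -lt0n ler1n ler_nat; congr andb.
by rewrite -[LHS]ltnS ltn_neqAle nN andbT.
Qed.

Lemma grid1 X Y z : z \in grid X Y -> z.1 \in X.
Proof. by case/allpairsP => -[x y] [/= ? ? ->]. Qed.

Lemma grid2 X Y z : z \in grid X Y -> z.2 \in Y.
Proof. by case/allpairsP => -[x y] [/= ? ? ->]. Qed.

Lemma ip_diff1 (R : realType) (X Y X' Y' : seq rat) (a : U R (grid X Y))
    (b : U R (grid X' Y')) (g bad : rat -> bool) :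
    {in X', forall x, g x = ~~ bad x} ->
  let bt x y := if bad x then 0 else ev b x y in
  ip (on_grid (grid X' Y') (fun x y =>
        if g x then ev a (x + halfq) y - ev a (x - halfq) y else 0)) b =
  - ip a (on_grid (grid X Y) (fun x y => bt (x + halfq) y - bt (x - halfq) y)).
Proof.
move=> gbad bt.
have := @ip_diff R _ _ a b (fun x _ => g x) (fun x _ => bad x) halfq 0
  (fun z zB => gbad _ (grid1 zB)).
rewrite /= /ip => E; transitivity (- \sum_q a q *
  (bt ((val q).1 + halfq) ((val q).2 + 0) - bt ((val q).1 - halfq) ((val q).2 - 0))).
  by rewrite -E; apply: eq_bigr => p _; rewrite ffunE ?oppr0 !addr0.
by congr (- _); apply: eq_bigr => p _; rewrite ffunE ?oppr0 !addr0.
Qed.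

Lemma ip_diff2 (R : realType) (X Y X' Y' : seq rat) (a : U R (grid X Y))
    (b : U R (grid X' Y')) (g bad : rat -> bool) :
    {in Y', forall y, g y = ~~ bad y} ->
  let bt x y := if bad y then 0 else ev b x y in
  ip (on_grid (grid X' Y') (fun x y =>
        if g y then ev a x (y + halfq) - ev a x (y - halfq) else 0)) b =
  - ip a (on_grid (grid X Y) (fun x y => bt x (y + halfq) - bt x (y - halfq))).
Proof.
move=> gbad bt.
have := @ip_diff R _ _ a b (fun _ y => g y) (fun _ y => bad y) 0 halfq
  (fun z zB => gbad _ (grid2 zB)).
rewrite /= /ip => E; transitivity (- \sum_q a q *
  (bt ((val q).1 + 0) ((val q).2 + halfq) - bt ((val q).1 - 0) ((val q).2 - halfq))).
  by rewrite -E; apply: eq_bigr => p _; rewrite ffunE ?oppr0 !addr0.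
by congr (- _); apply: eq_bigr => p _; rewrite ffunE ?oppr0 !addr0.
Qed.

Lemma divnew_adjoint (R : realType) (N1 N2 : nat)
    (u : U R (A_bullet N1 N2)) (w : U2 R N1 N2) :
  ip2 (Dnew u) w = - ip u (divnew w).
Proof.
rewrite /ip2 (ip_diff1 u w.1 (@edge_guard N1)) (ip_diff2 u w.2 (@edge_guard N2)).
rewrite -opprD /ip -big_split /=; congr (- _); apply: eq_bigr => p _.
by rewrite !ffunE -mulrDr !addrA.
Qed.

Lemma Divnew_adjoint (R : realType) (N1 N2 : nat)
    (w : U2 R N1 N2) (v : U3 R N1 N2) :
  ip3 (Enew w) v = - ip2 w (Divnew v).
Proof.
rewrite /ip3 (ip_diff1 w.1 v.1.1 (@ghosted_guard N1))
  (ip_diff2 w.2 v.1.2 (@ghosted_guard N2)).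
have := ip_diff2 w.1 v.2 (@edge_guard N2); have := ip_diff1 w.2 v.2 (@edge_guard N1).
rewrite /= => E1 E2.
have -> : 2 * ip (Enew w).2 v.2 =
    ip (on_grid (A_cross N1 N2) (fun x y => if 3 / 2 <= x <= N1%:R - halfq
       then ev w.2 (x + halfq) y - ev w.2 (x - halfq) y else 0)) v.2 +
    ip (on_grid (A_cross N1 N2) (fun x y => if 3 / 2 <= y <= N2%:R - halfq
       then ev w.1 x (y + halfq) - ev w.1 x (y - halfq) else 0)) v.2.
  rewrite /ip mulr_sumr -big_split /=; apply: eq_bigr => p _.
  by rewrite !ffunE /=; field.
rewrite E1 E2 -!opprD; congr (- _); rewrite addrACA [X in _ + X]addrC addrACA /ip2.
congr (_ + _); last rewrite [LHS]addrC.
  by rewrite /ip -big_split; apply: eq_bigr => p _; rewrite /= !ffunE -mulrDr !addrA.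
by rewrite /ip -big_split; apply: eq_bigr => p _; rewrite /= !ffunE -mulrDr !addrA.
Qed.

Import VectorInternalTheory.

Lemma compact_lin_max (R : realType) (V : vectType R) (k : nat)
    (T : {linear V -> 'rV[R]_k}) (f : {linear V -> 'rV[R]_1})
    (C : set 'rV[R]_k) :
    compact C -> (forall v, T v = 0 -> f v = 0) -> (exists v, C (T v)) ->
  exists2 v, C (T v) & forall v', C (T v') -> f v' 0 0 <= f v 0 0.
Proof.
move=> cC kerT [v0 Cv0].
pose M := lin1_mx (T \o r2v); pose G := lin1_mx (f \o r2v).
have ME v : v2r v *m M = T v by rewrite mul_rV_lin1 /= v2rK.
have GE v : v2r v *m G = f v by rewrite mul_rV_lin1 /= v2rK.
have [H GH] : exists H, G = M *m H.
  have /submxP[D GD] : (G^T <= M^T)%MS.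
    rewrite submxE -trmx_eq0 trmx_mul trmxK; apply/eqP/row_matrixP => i.
    rewrite row_mul row0 -[row i _]r2vK GE; apply: kerT.
    rewrite -ME r2vK -row_mul.
    have -> : (cokermx M^T)^T *m M = 0.
      by rewrite -[X in _ *m X]trmxK -trmx_mul mulmx_coker trmx0.
    exact: row0.
  by exists D^T; rewrite -[LHS]trmxK GD trmx_mul trmxK.
pose K := C `&` [set y | y *m cokermx M = 0].
have cont m (X : 'M[R]_(k, m)) (j : 'I_m) : continuous (fun y : 'rV[R]_k => (y *m X) 0 j).
  move=> y.
  have -> : (fun y : 'rV[R]_k => (y *m X) 0 j) =
      (fun y => \sum_i y 0 i * X i j) by apply/funext => z; rewrite mxE.
  apply: (@cvg_big _ _ _ _ _ _ _ (nbhs y)) => [|i _]; first exact: add_continuous.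
  by apply: cvgMr_tmp; exact: coord_continuous.
have cK : compact K.
  apply: compact_closedI => //.
  have -> : [set y | y *m cokermx M = 0] =
      \bigcap_(j in [set: 'I_k]) [set y : 'rV[R]_k | (y *m cokermx M) 0 j = 0].
    apply/seteqP; split=> y /= h; first by move=> j _ /=; rewrite h mxE.
    by apply/rowP => j; rewrite (h j I) mxE.
  apply: closed_bigI => j _.
  apply: (@preimage_closed _ _ (fun y : 'rV[R]_k => (y *m cokermx M) 0 j) [set 0]).
    by move=> y _; exact: cont.
  exact: closed_eq.
have KT v : C (T v) -> K (T v).
  by move=> Cv; split => //=; rewrite -ME -mulmxA mulmx_coker mulmx0.
have [|c /set_mem[Cc Mc] cmax] := EVT_max_rV _ cK
    (continuous_subspaceT (@cont _ H 0)).
  by exists (T v0); exact: KT.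
have /submxP[x cx] : (c <= M)%MS by rewrite submxE; apply/eqP.
have cE : c = T (r2v x) by rewrite -ME r2vK.
exists (r2v x); first by rewrite -cE.
by move=> v' /KT/mem_set/cmax; rewrite cE -!GE -!ME GH !mulmxA.
Qed.

Definition linear_form (R : realType) (V : lmodType R) (F : V -> R) :=
  forall a x y, F (a *: x + y) = a * F x + F y.

Lemma quad_lin_max (R : realType) (V : vectType R) (J : finType)
    (l : option bool -> J -> V -> R) (f : V -> R) (b : J -> R) :
    (forall e j, linear_form (l e j)) -> linear_form f ->
    (forall v, (forall e j, l e j v = 0) -> f v = 0) -> (forall j, 0 <= b j) ->
  let adm v := forall j,
    l None j v ^+ 2 + l (Some true) j v ^+ 2 + 2 * l (Some false) j v ^+ 2 <= b j in
  exists2 v, adm v & forall v', adm v' -> f v' <= f v.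
Proof.
move=> ll lf lker b_ge0 adm.
pose r e j : 'I_#|{: option bool * J}| := enum_rank (e, j).
pose T v : 'rV[R]_#|{: option bool * J}| :=
  \row_i l (enum_val i).1 (enum_val i).2 v.
pose g v : 'rV[R]_1 := const_mx (f v).
have lT : linear T by move=> a x y; apply/rowP => i; rewrite !mxE ll.
have lg : linear g by move=> a x y; apply/rowP => i; rewrite !mxE lf.
pose T' : {linear V -> 'rV[R]_#|{: option bool * J}|} :=
  HB.pack T (GRing.isLinear.Build _ _ _ _ T lT).
pose g' : {linear V -> 'rV[R]_1} := HB.pack g (GRing.isLinear.Build _ _ _ _ g lg).
have TE v e j : T v 0 (r e j) = l e j v by rewrite mxE enum_rankK.
pose Q j (y : 'rV[R]_#|{: option bool * J}|) := y 0 (r None j) ^+ 2 +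
  y 0 (r (Some true) j) ^+ 2 + 2 * y 0 (r (Some false) j) ^+ 2.
pose C := \bigcap_(j in [set: J]) [set y | Q j y <= b j].
have CT v : C (T v) <-> adm v.
  by split=> h j; [move: (h j I)|move=> _; move: (h j)]; rewrite /Q /= !TE.
have cC : compact C.
  apply: bounded_closed_compact.
    exists (1 + \sum_j b j); split; first exact: num_real.
    move=> M ltM y Cy; rewrite /= {1}/Num.norm /= mx_normrE; apply/bigmax_leP.
    have S_ge0 : 0 <= \sum_j b j by apply: sumr_ge0 => j _; exact: b_ge0.
    split=> [|[i0 i] _ /=]; first by lra.
    rewrite ord1; have [e [j ->]] : exists e j, i = r e j.
      by exists (enum_val i).1, (enum_val i).2; rewrite /r -surjective_pairing enum_valK.
    have bS : b j <= \sum_j b j.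
      by rewrite (bigD1 j) //= lerDl sumr_ge0 // => k _; exact: b_ge0.
    have : y 0 (r e j) ^+ 2 <= b j.
      apply: le_trans (Cy j I); rewrite /Q.
      have := sqr_ge0 (y 0 (r None j)); have := sqr_ge0 (y 0 (r (Some true) j)).
      by have := sqr_ge0 (y 0 (r (Some false) j)); case: e => [[]|]; lra.
    rewrite -real_normK ?num_real // => yb; have := normr_ge0 (y 0 (r e j)).
    by rewrite leNgt => ?; apply/negP => ?; nra.
  apply: closed_bigI => j _.
  apply: (@preimage_closed _ _ (Q j) [set x | x <= b j]); last exact: closed_le.
  move=> y _; have cc i : (fun z : 'rV[R]_#|{: option bool * J}| => z 0 i ^+ 2) @ y -->
      y 0 i ^+ 2.
    by apply: (@cvg_comp _ _ _ (fun z : 'rV[R]_#|{: option bool * J}| => z 0 i)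
      (fun x => x ^+ 2)); [exact: coord_continuous|exact: exprn_continuous].
  exact: (cvgD (cvgD (cc (r None j)) (cc (r (Some true) j)))
    (cvgMl_tmp (cc (r (Some false) j)) (a := 2))).
have [|| v Cv vmax] := @compact_lin_max R V _ T' g' C cC.
- move=> v /rowP Tv; apply/rowP => i; rewrite !mxE; apply: lker => e j.
  by rewrite -TE; have := Tv (r e j); rewrite [RHS]mxE.
- exists 0; apply/CT => j; have l0 e : l e j 0 = 0.
    by have := ll e j (-1) 0 0; rewrite scaler0 addr0 mulN1r addNr.
  by rewrite !l0 expr0n /= mulr0 !addr0.
exists v; first exact/CT.
by move=> v' /CT/vmax; rewrite !mxE.
Qed.

Lemma linear_form_ev (R : realType) (V : lmodType R) (A : seq (rat * rat))
    (g : V -> U R A) x y :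
  (forall p, linear_form (fun v => g v p)) -> linear_form (fun v => ev (g v) x y).
Proof.
move=> lg a v w; rewrite /ev; case: insubP => [p _ _|_]; first exact: lg.
by rewrite mulr0 addr0.
Qed.

Lemma linear_form0 (R : realType) (V : lmodType R) : linear_form (fun _ : V => 0 : R).
Proof. by move=> a x y; rewrite mulr0 addr0. Qed.

Lemma linear_formD (R : realType) (V : lmodType R) (F G : V -> R) :
  linear_form F -> linear_form G -> linear_form (fun v => F v + G v).
Proof. by move=> lF lG a x y; rewrite lF lG mulrDr addrACA. Qed.

Lemma linear_formN (R : realType) (V : lmodType R) (F : V -> R) :
  linear_form F -> linear_form (fun v => - F v).
Proof. by move=> lF a x y; rewrite lF opprD mulrN. Qed.

Lemma linear_formM (R : realType) (V : lmodType R) (c : R) (F : V -> R) :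
  linear_form F -> linear_form (fun v => c * F v).
Proof. by move=> lF a x y; rewrite lF mulrDr mulrCA. Qed.

Lemma linear_form_if (R : realType) (V : lmodType R) (b : bool) (F : V -> R) :
  linear_form F -> linear_form (fun v => if b then 0 else F v).
Proof. by case: b => // _; exact: linear_form0. Qed.

Lemma linear_form_sum (R : realType) (V : lmodType R) (I : Type) (s : seq I)
    (F : I -> V -> R) :
  (forall i, linear_form (F i)) -> linear_form (fun v => \sum_(i <- s) F i v).
Proof.
move=> lF a x y; rewrite mulr_sumr -big_split /=.
by apply: eq_bigr => i _; exact: lF.
Qed.

Lemma linear_form_grid (R : realType) (V : lmodType R) (A : seq (rat * rat))
    (F : V -> rat -> rat -> R) :
  (forall x y, linear_form (fun v => F v x y)) ->
  forall p, linear_form (fun v => on_grid A (F v) p).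
Proof. by move=> lF p a v w; rewrite !ffunE lF. Qed.

Lemma linear_form_avg4 (R : realType) (V : lmodType R) (A : seq (rat * rat))
    (g : V -> U R A) x y :
  (forall p, linear_form (fun v => g v p)) ->
  linear_form (fun v => avg4 (g v) x y).
Proof.
move=> lg; apply: linear_formM; apply: linear_form_sum => e.
by apply: linear_form_sum => d; exact: linear_form_ev.
Qed.

Lemma norm2_le (R : realType) (A : seq (rat * rat)) (f : U R A * U R A) (a : R) :
  0 < a -> norm2 f <= a <-> forall p, f.1 p ^+ 2 + f.2 p ^+ 2 + 2 * 0 ^+ 2 <= a ^+ 2.
Proof.
move=> a0; have sE x : (Num.sqrt x <= a) = (x <= a ^+ 2).
  by rewrite -{1}(gtr0_norm a0) -sqrtr_sqr ler_sqrt // sqr_ge0.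
rewrite expr0n /= mulr0; split=> [/bigmax_leP[_ h] p|h].
  by rewrite addr0 -sE; exact: h.
by apply/bigmax_leP; split=> [|p _]; [exact: ltW|rewrite sE -[leLHS]addr0; exact: h].
Qed.

Lemma norm3_le (R : realType) (A : seq (rat * rat)) (f : U R A * U R A * U R A)
    (a : R) : 0 < a -> norm3 f <= a <->
  forall p, f.1.1 p ^+ 2 + f.1.2 p ^+ 2 + 2 * f.2 p ^+ 2 <= a ^+ 2.
Proof.
move=> a0; have sE x : (Num.sqrt x <= a) = (x <= a ^+ 2).
  by rewrite -{1}(gtr0_norm a0) -sqrtr_sqr ler_sqrt // sqr_ge0.
split=> [/bigmax_leP[_ h] p|h]; first by rewrite -sE; exact: h.
by apply/bigmax_leP; split=> [|p _]; [exact: ltW|rewrite sE; exact: h].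
Qed.

Lemma tgv_values_max (R : realType) (N1 N2 : nat) (a0 a1 : R)
    (u : U R (A_bullet N1 N2)) : 0 < a0 -> 0 < a1 ->
  exists2 m, tgv_values a0 a1 u m & ubound (tgv_values a0 a1 u) m.
Proof.
move=> a0_gt0 a1_gt0.
pose V : vectType R := ({ffun seq_sub (A_barx N1 N2) -> R^o} *
  {ffun seq_sub (A_bary N1 N2) -> R^o} * {ffun seq_sub (A_cross N1 N2) -> R^o})%type.
pose J : finType := (seq_sub (A_bullet N1 N2) + (seq_sub (A_bullet N1 N2) +
  (seq_sub (A_hor N1 N2) + seq_sub (A_ver N1 N2))))%type.
pose c2 (A : seq (rat * rat)) (g : U R A * U R A) (e : option bool) (p : seq_sub A) : R :=
  match e with None => g.1 p | Some true => g.2 p | _ => 0 end.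
pose l (e : option bool) (j : J) (v : V) : R := match j with
  | inl p => match e with None => (L_bullet3 v).1.1 p
             | Some true => (L_bullet3 v).1.2 p | _ => (L_bullet3 v).2 p end
  | inr (inl p) => c2 _ (L_bullet (Divnew v)) e p
  | inr (inr (inl p)) => c2 _ (L_hor (Divnew v)) e p
  | inr (inr (inr p)) => c2 _ (L_ver (Divnew v)) e p end.
pose b (j : J) := if j is inl _ then a0 ^+ 2 else a1 ^+ 2.
have lv1 p : linear_form (fun v : V => v.1.1 p) by move=> a x y; rewrite !ffunE.
have lv2 p : linear_form (fun v : V => v.1.2 p) by move=> a x y; rewrite !ffunE.
have lv3 p : linear_form (fun v : V => v.2 p) by move=> a x y; rewrite !ffunE.
have lw1 p : linear_form (fun v : V => (Divnew v).1 p).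
  apply: linear_form_grid => x y.
  by do 3 ?[apply: linear_formD]; try apply: linear_formN;
    apply: linear_form_if; exact: linear_form_ev.
have lw2 p : linear_form (fun v : V => (Divnew v).2 p).
  apply: linear_form_grid => x y.
  by do 3 ?[apply: linear_formD]; try apply: linear_formN;
    apply: linear_form_if; exact: linear_form_ev.
have [|||| v adm vmax] := @quad_lin_max R V J l
    (fun v => ip u (divnew (Divnew v))) b.
- case=> [[]|] [p|[p|[p|p]]]; rewrite /l /c2;
  do ?[exact: lw1 | exact: lw2 | exact: linear_form0];
  apply: linear_form_grid => x y;
  do ?[exact: linear_form_ev | exact: linear_form_avg4];
  by apply: linear_formM; apply: linear_formD; exact: linear_form_ev.
- apply: linear_form_sum => p; apply: linear_formM.
  apply: (@linear_form_grid _ V _ (fun v => _)) => x y.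
  by do 3 ?[apply: linear_formD]; try apply: linear_formN;
    apply: linear_form_if; exact: linear_form_ev.
- move=> v lv; rewrite /ip big1 // => p _; rewrite ffunE.
  have z1 x y : ev (Divnew v).1 x y = 0.
    rewrite /ev; case: insubP => // q _ _.
    exact: (lv None (inr (inr (inl q)))).
  have z2 x y : ev (Divnew v).2 x y = 0.
    rewrite /ev; case: insubP => // q _ _.
    exact: (lv (Some true) (inr (inr (inr q)))).
  by rewrite !z1 !z2 !if_same !subr0 addr0 mulr0.
- by case=> [p|p]; rewrite /b sqr_ge0.
have admE (v' : V) : tgv_admissible N1 N2 a0 a1 v' <->
    forall j, l None j v' ^+ 2 + l (Some true) j v' ^+ 2 +
              2 * l (Some false) j v' ^+ 2 <= b j.
  rewrite /tgv_admissible /=; split.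
    case=> /(norm3_le _ a0_gt0) h0 /(norm2_le _ a1_gt0) h1.
    by move=> /(norm2_le _ a1_gt0) h2 /(norm2_le _ a1_gt0) h3 [|[|[]]].
  move=> h; split; [apply/(norm3_le _ a0_gt0)|apply/(norm2_le _ a1_gt0)
    |apply/(norm2_le _ a1_gt0)|apply/(norm2_le _ a1_gt0)] => p.
  + exact: (h (inl p)).
  + exact: (h (inr (inl p))).
  + exact: (h (inr (inr (inl p)))).
  + exact: (h (inr (inr (inr p)))).
exists (ip u (divnew (Divnew v))); first by exists v => //; exact/admE.
by move=> _ [v' /admE/vmax h <-].
Qed.

Lemma TGV2new_max (R : realType) (N1 N2 : nat) (a0 a1 : R)
    (u : U R (A_bullet N1 N2)) : 0 < a0 -> 0 < a1 ->
  tgv_values a0 a1 u (TGV2new a0 a1 u) /\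
  ubound (tgv_values a0 a1 u) (TGV2new a0 a1 u).
Proof.
move=> a0_gt0 a1_gt0; have [m mv mub] := tgv_values_max u a0_gt0 a1_gt0.
suff -> : TGV2new a0 a1 u = m by [].
apply/eqP; rewrite eq_le; apply/andP; split.
  by apply: ge_sup => //; exists m.
by apply: ub_le_sup => //; exists m.
Qed.

(* Main.v *)
Require Import Defs.
From mathcomp Require Import all_boot all_order all_algebra.
From mathcomp Require Import all_classical all_reals all_analysis.
From mathcomp Require Import ring lra.
Import Order.TTheory GRing.Theory Num.Theory.

Set Implicit Arguments.
Unset Strict Implicit.
Unset Printing Implicit Defensive.

Local Open Scope ring_scope.

(** Write [rho (x, y) = (y, N2 + 1 - x)], so that the rotated image is
    [u o rho].  If [v] is a dual field for [u], then
    [(v2 o rho, v1 o rho, - v3 o rho)] is a dual field for the rotated image: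
    its divergence is [(- w2 o rho, w1 o rho)] with [w = Div v], its second
    divergence is [(div w) o rho], and [rho] permutes the grids on which the
    constraints are imposed, those for [w1] and [w2] being exchanged.  Hence
    every value attained for [u] is attained for the rotated image; rotating
    four times gives back [u], so all these inclusions are equalities. *)

Lemma ev_on_grid (R : realType) (A : seq (rat * rat)) (F : rat -> rat -> R) x y :
  ev (on_grid A F) x y = if (x, y) \in A then F x y else 0.
Proof.
rewrite /ev; case: insubP => [p pA vp|/negbTE ->//].
by rewrite ffunE vp pA.
Qed.

Lemma mem_grid (X Y : seq rat) x y : ((x, y) \in grid X Y) = (x \in X) && (y \in Y).
Proof.
apply/allpairsP/andP => [[[s t]] [/= sX tY [-> ->]]//|[xX yY]].
by exists (x, y).
Qed.

(** * Symmetry of the one-dimensional grids under [x -> N + 1 - x] *)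

Section Reflection.
Variable N : nat.

(** The reflection is an involution, so stability of [X] in one direction already gives the
    equivalence. *)
Lemma reflect_mem (X : seq rat) :
    (forall x, x \in X -> N%:R + 1 - x \in X) ->
  forall x, (N%:R + 1 - x \in X) = (x \in X).
Proof.
by move=> h x; apply/idP/idP => /h //; rewrite subKr.
Qed.

Lemma cells_reflect x : (N%:R + 1 - x \in cells N) = (x \in cells N).
Proof.
apply: reflect_mem => {}x /mapP[n]; rewrite mem_iota add1n ltnS => /andP[n0 nN] ->.
apply/mapP; exists (N.+1 - n)%N; last by rewrite natrB ?natr1 // ltnW.
by rewrite mem_iota add1n ltnS subn_gt0 ltnS nN leq_subLR -addn1 addnC leq_add2r.
Qed.

Lemma edges_reflect x : (N%:R + 1 - x \in edges N) = (x \in edges N).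
Proof.
apply: reflect_mem => {}x /mapP[n]; rewrite mem_iota add0n ltnS => /andP[_ nN] ->.
(* Edges carry the offset 1/2 and [N + 1 - (n + 1/2) = (N - n) + 1/2], whence [N - n] in place of
   [N + 1 - n]. *)
apply/mapP; exists (N - n)%N; last by rewrite natrB // /halfq; lra.
by rewrite mem_iota add0n ltnS leq_subr.
Qed.

Lemma ghosted_reflect x : (N%:R + 1 - x \in ghosted N) = (x \in ghosted N).
Proof.
apply: reflect_mem => {}x /mapP[n]; rewrite mem_iota add0n ltnS => /andP[_ nN] ->.
apply/mapP; exists (N.+1 - n)%N; last by rewrite natrB // natr1.
by rewrite mem_iota add0n ltnS leq_subr.
Qed.

(** The two end points are swapped, so the set on which [divnew] and [Divnew] put zeros is
    preserved. *)
Lemma edge_ends_reflect (x : rat) :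
  (N%:R + 1 - x \in [:: halfq; N%:R + halfq]) = (x \in [:: halfq; N%:R + halfq]).
Proof.
rewrite !inE /halfq orbC; congr orb; apply/eqP/eqP; lra.
Qed.

Lemma ghost_ends_reflect (x : rat) :
  (N%:R + 1 - x \in [:: 0; N%:R + 1]) = (x \in [:: 0; N%:R + 1]).
Proof. rewrite !inE orbC; congr orb; apply/eqP/eqP; lra. Qed.

End Reflection.

(** [B] is the preimage of [A] under [rho]. Quantifying over all rational points makes the zero
    values off the grids correspond as well. *)
Definition rho_grid (c : rat) (B A : seq (rat * rat)) :=
  forall x y, ((x, y) \in B) = ((y, c - x) \in A).

Lemma rho_grid_product (N : nat) (X Y : seq rat) :
    (forall x, (N%:R + 1 - x \in X) = (x \in X)) ->
  rho_grid (N%:R + 1) (grid X Y) (grid Y X).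
Proof. by move=> h x y; rewrite !mem_grid h andbC. Qed.

Definition rotate (R : realType) (c : rat) (A B : seq (rat * rat)) (f : U R A) :
  U R B := on_grid B (fun x y => ev f y (c - x)).
Arguments rotate {R} c {A} B f.

Definition rotateN (R : realType) (c : rat) (A B : seq (rat * rat)) (f : U R A) :
  U R B := on_grid B (fun x y => - ev f y (c - x)).
Arguments rotateN {R} c {A} B f.

Lemma ev_on_grid_rho (R : realType) (c : rat) (A B : seq (rat * rat))
    (F G : rat -> rat -> R) x y : rho_grid c B A ->
    (forall s t, F s t = G t (c - s)) ->
  ev (on_grid B F) x y = ev (on_grid A G) y (c - x).
Proof. by move=> BA FG; rewrite !ev_on_grid BA FG. Qed.

Lemma ev_on_grid_rhoN (R : realType) (c : rat) (A B : seq (rat * rat))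
    (F G : rat -> rat -> R) x y : rho_grid c B A ->
    (forall s t, F s t = - G t (c - s)) ->
  ev (on_grid B F) x y = - ev (on_grid A G) y (c - x).
Proof. by move=> BA FG; rewrite !ev_on_grid BA FG; case: ifP; rewrite ?oppr0. Qed.

Lemma on_grid_ev (R : realType) (A : seq (rat * rat)) (f : U R A) :
  on_grid A (ev f) = f.
Proof. by apply/ffunP => p; rewrite ffunE evval. Qed.

Lemma ev_rotate (R : realType) (c : rat) (A B : seq (rat * rat)) (f : U R A) x y :
  rho_grid c B A -> ev (rotate c B f) x y = ev f y (c - x).
Proof. by move=> BA; rewrite (ev_on_grid_rho (G := ev f) _ _ BA) // on_grid_ev. Qed.

Lemma ev_rotateN (R : realType) (c : rat) (A B : seq (rat * rat)) (f : U R A) x y :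
  rho_grid c B A -> ev (rotateN c B f) x y = - ev f y (c - x).
Proof. by move=> BA; rewrite (ev_on_grid_rhoN (G := ev f) _ _ BA) // on_grid_ev. Qed.

Lemma ev_inj (R : realType) (A : seq (rat * rat)) (f g : U R A) :
  (forall x y, ev f x y = ev g x y) -> f = g.
Proof. by move=> fg; apply/ffunP => p; rewrite -!evval fg. Qed.

Lemma ip_rho (R : realType) (c : rat) (A B : seq (rat * rat))
    (f g : U R A) (f' g' : U R B) : rho_grid c B A ->
    (forall x y, ev f' x y = ev f y (c - x)) ->
    (forall x y, ev g' x y = ev g y (c - x)) ->
  ip f' g' = ip f g.
Proof.
move=> BA ff gg.
have hA (p : seq_sub B) : ((val p).2, c - (val p).1) \in A.
  by rewrite -BA -surjective_pairing (valP p).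
have hB (q : seq_sub A) : (c - (val q).2, (val q).1) \in B.
  by rewrite BA subKr -surjective_pairing (valP q).
(* [rho] restricts to a bijection from [B] to [A], with inverse [(s, t) -> (c - t, s)]. *)
rewrite /ip [RHS](reindex (fun p => SeqSub (hA p))) /=; last first.
  exists (fun q => SeqSub (hB q)) => p _; apply: val_inj => /=;
    by rewrite subKr -surjective_pairing.
by apply: eq_bigr => p _; rewrite -!evval ff gg.
Qed.

(* Off the grid [ev] vanishes, so the constraint may be read at all points. *)
Lemma norm2_ev_le (R : realType) (A : seq (rat * rat)) (f : U R A * U R A) (a : R) :
  0 < a -> norm2 f <= a <->
  forall x y, ev f.1 x y ^+ 2 + ev f.2 x y ^+ 2 <= a ^+ 2.
Proof.
move=> a0; rewrite (norm2_le _ a0); split=> h.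
  move=> x y; rewrite /ev; case: insubP => [p _ _|_].
    by have := h p; rewrite expr0n mulr0 addr0.
  by rewrite expr0n addr0 sqr_ge0.
by move=> p; rewrite expr0n mulr0 addr0 -!evval.
Qed.

Lemma norm3_ev_le (R : realType) (A : seq (rat * rat))
    (f : U R A * U R A * U R A) (a : R) :
  0 < a -> norm3 f <= a <->
  forall x y, ev f.1.1 x y ^+ 2 + ev f.1.2 x y ^+ 2 + 2 * ev f.2 x y ^+ 2 <= a ^+ 2.
Proof.
move=> a0; rewrite (norm3_le _ a0); split=> h; last by move=> p; rewrite -!evval.
move=> x y; rewrite /ev; case: insubP => [p _ _|_]; first exact: h.
by rewrite expr0n mulr0 !addr0 sqr_ge0.
Qed.

(** * Behaviour of the operators and constraints under the quarter turn *)

Section Rotation.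
Variables (R : realType) (N1 N2 : nat).
Notation c := (N2%:R + 1 : rat).

Let bulletR : rho_grid c (A_bullet N2 N1) (A_bullet N1 N2).
Proof. exact/rho_grid_product/cells_reflect. Qed.

Let horR : rho_grid c (A_hor N2 N1) (A_ver N1 N2).
Proof. exact/rho_grid_product/edges_reflect. Qed.

Let verR : rho_grid c (A_ver N2 N1) (A_hor N1 N2).
Proof. exact/rho_grid_product/cells_reflect. Qed.

Let barxR : rho_grid c (A_barx N2 N1) (A_bary N1 N2).
Proof. exact/rho_grid_product/ghosted_reflect. Qed.

Let baryR : rho_grid c (A_bary N2 N1) (A_barx N1 N2).
Proof. exact/rho_grid_product/cells_reflect. Qed.

Let crossR : rho_grid c (A_cross N2 N1) (A_cross N1 N2).
Proof. exact/rho_grid_product/edges_reflect. Qed.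

Let reflectD (x e : rat) : c - (x + e) = c - x - e.
Proof. by ring. Qed.

(** The signs here and in [rotate3] follow the chain rule: [u o rho] has gradient
    [(- u_y, u_x) o rho] and mixed second derivative [- u_xy o rho]. *)
Definition rotate2 (w : U2 R N1 N2) : U2 R N2 N1 :=
  (rotateN c (A_hor N2 N1) w.2, rotate c (A_ver N2 N1) w.1).

Definition rotate3 (v : U3 R N1 N2) : U3 R N2 N1 :=
  (rotate c (A_barx N2 N1) v.1.2, rotate c (A_bary N2 N1) v.1.1,
   rotateN c (A_cross N2 N1) v.2).

Lemma ev_rotate90 (u : U R (A_bullet N1 N2)) x y :
  ev (rotate90 u) x y = ev u y (c - x).
Proof.
rewrite -[in RHS](on_grid_ev u); apply: ev_on_grid_rho => // s t.
by rewrite addrAC.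
Qed.

Lemma Divnew_rotate3 (v : U3 R N1 N2) : Divnew (rotate3 v) = rotate2 (Divnew v).
Proof.
congr pair; apply: ev_inj => x y.
  rewrite ev_rotateN //; apply: ev_on_grid_rhoN => // s t.
  (* Only the guards in the first coordinate need reflecting; those in the second match as they
     stand. Reflection turns the shift [+ halfq] into [- halfq], which gives the sign of the
     difference. *)
  rewrite /= !ev_rotate // !ev_rotateN //
    -(ghost_ends_reflect N2 (s + halfq)) -(ghost_ends_reflect N2 (s - halfq)).
  rewrite !(reflectD s) !opprK.
  by do ! case: ifP => _; ring.
rewrite ev_rotate //; apply: ev_on_grid_rho => // s t.
rewrite /= !ev_rotate // !ev_rotateN //
    -(edge_ends_reflect N2 (s + halfq)) -(edge_ends_reflect N2 (s - halfq)).
rewrite !(reflectD s) !opprK.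
by do ! case: ifP => _; ring.
Qed.

Lemma divnew_rotate2 (w : U2 R N1 N2) x y :
  ev (divnew (rotate2 w)) x y = ev (divnew w) y (c - x).
Proof.
apply: ev_on_grid_rho => // s t.
rewrite /= !ev_rotate // !ev_rotateN //
    -(edge_ends_reflect N2 (s + halfq)) -(edge_ends_reflect N2 (s - halfq)).
rewrite !(reflectD s) !opprK.
by do ! case: ifP => _; ring.
Qed.

(** The four diagonal offsets are permuted by the quarter turn. *)
Lemma avg4_rotate (A B : seq (rat * rat)) (f : U R A) x y :
  rho_grid c B A -> avg4 (rotate c B f) x y = avg4 f y (c - x).
Proof.
move=> BA; rewrite /avg4 !big_cons !big_nil !ev_rotate // !reflectD !opprK.
by ring.
Qed.

Lemma avg4_rotateN (A B : seq (rat * rat)) (f : U R A) x y :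
  rho_grid c B A -> avg4 (rotateN c B f) x y = - avg4 f y (c - x).
Proof.
move=> BA; rewrite /avg4 !big_cons !big_nil !ev_rotateN // !reflectD !opprK.
by ring.
Qed.

Lemma norm3_L_bullet3_rotate (v : U3 R N1 N2) (a : R) : 0 < a ->
  norm3 (L_bullet3 v) <= a -> norm3 (L_bullet3 (rotate3 v)) <= a.
Proof.
move=> a0 /(norm3_ev_le _ a0) h; apply/(norm3_ev_le _ a0) => x y.
rewrite /= (@ev_on_grid_rho _ _ _ _ _ (ev v.1.2) _ _ bulletR); last first.
  by move=> s t; rewrite ev_rotate.
rewrite (@ev_on_grid_rho _ _ _ _ _ (ev v.1.1) _ _ bulletR); last first.
  by move=> s t; rewrite ev_rotate.
rewrite (@ev_on_grid_rhoN _ _ _ _ _ (avg4 v.2) _ _ bulletR); last first.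
  by move=> s t; rewrite avg4_rotateN.
(* Pointwise the diagonal entries are swapped and the sign of the off-diagonal one is squared
   away. *)
by rewrite sqrrN [X in X + _]addrC; exact: h.
Qed.

Lemma norm2_L_bullet_rotate (w : U2 R N1 N2) (a : R) : 0 < a ->
  norm2 (L_bullet w) <= a -> norm2 (L_bullet (rotate2 w)) <= a.
Proof.
move=> a0 /(norm2_ev_le _ a0) h; apply/(norm2_ev_le _ a0) => x y.
have -> : ev (L_bullet (rotate2 w)).1 x y = - ev (L_bullet w).2 y (c - x).
  apply: ev_on_grid_rhoN => // s t.
  by rewrite /= !ev_rotateN // !reflectD opprK; ring.
have -> : ev (L_bullet (rotate2 w)).2 x y = ev (L_bullet w).1 y (c - x).
  by apply: ev_on_grid_rho => // s t; rewrite /= !ev_rotate.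
by rewrite sqrrN addrC.
Qed.

Lemma norm2_L_hor_rotate (w : U2 R N1 N2) (a : R) : 0 < a ->
  norm2 (L_ver w) <= a -> norm2 (L_hor (rotate2 w)) <= a.
Proof.
move=> a0 /(norm2_ev_le _ a0) h; apply/(norm2_ev_le _ a0) => x y.
rewrite /= ev_rotateN // (@ev_on_grid_rho _ _ _ _ _ (avg4 w.1) _ _ horR).
  by rewrite sqrrN addrC; exact: h.
by move=> s t; rewrite avg4_rotate.
Qed.

Lemma norm2_L_ver_rotate (w : U2 R N1 N2) (a : R) : 0 < a ->
  norm2 (L_hor w) <= a -> norm2 (L_ver (rotate2 w)) <= a.
Proof.
move=> a0 /(norm2_ev_le _ a0) h; apply/(norm2_ev_le _ a0) => x y.
rewrite /= ev_rotate // (@ev_on_grid_rhoN _ _ _ _ _ (avg4 w.2) _ _ verR).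
  by rewrite sqrrN addrC; exact: h.
by move=> s t; rewrite avg4_rotateN.
Qed.

Lemma tgv_values_rotate90 (a0 a1 : R) (u : U R (A_bullet N1 N2)) :
  0 < a0 -> 0 < a1 ->
  (tgv_values a0 a1 u `<=` tgv_values a0 a1 (rotate90 u))%classic.
Proof.
move=> a0_gt0 a1_gt0 _ [v [hv hb hh hw] <-]; exists (rotate3 v).
  rewrite /tgv_admissible /= Divnew_rotate3; split.
  - exact: norm3_L_bullet3_rotate.
  - exact: norm2_L_bullet_rotate.
  - exact: norm2_L_hor_rotate.
  - exact: norm2_L_ver_rotate.
rewrite Divnew_rotate3; apply: ip_rho bulletR _ _; first exact: ev_rotate90.
exact: divnew_rotate2.
Qed.

End Rotation.

(** Two quarter turns reflect both coordinates, and a second such pair undoes this. *)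
Lemma rotate90_4 (R : realType) (N1 N2 : nat) (u : U R (A_bullet N1 N2)) :
  rotate90 (rotate90 (rotate90 (rotate90 u))) = u.
Proof. by apply: ev_inj => x y; rewrite !ev_rotate90 !subKr. Qed.

Theorem theorem4p1 (R : realType) (N1 N2 : nat) (a0 a1 : R)
    (N1_gt0 : (0 < N1)%N) (N2_gt0 : (0 < N2)%N)
    (a0_gt0 : 0 < a0) (a1_gt0 : 0 < a1)
    (u : U R (A_bullet N1 N2)) :
  TGV2new a0 a1 (rotate90 u) = TGV2new a0 a1 u.
Proof.
congr sup; apply/seteqP; split; last exact: tgv_values_rotate90.
(* With [u] seen as its own fourth rotation, three more quarter turns lead there from [rotate90 u],
   each one enlarging or keeping the value set. *)
rewrite -[X in (_ `<=` tgv_values _ _ X)%classic](rotate90_4 u).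
do 2 (apply: subset_trans; last exact: tgv_values_rotate90).
exact: tgv_values_rotate90.
Qed.
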